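(* Let $(\mathcal{M},g_{\mathcal{M}})$ be a complete Riemannian manifold with finitely many connected components, endowed with a distance function $d_{\mathcal{M}}$ compatible with the topology of $\mathcal{M}$ whose restriction to each connected component of $\mathcal{M}$ is the Riemannian distance function. Let $\mathcal{H}=(C,F,D,G,\mathcal{M})$ be a geometric hybrid dynamical system. A nonempty, compact set $\mathcal{A}\subset\mathcal{M}$ is uniformly globally stable for $\mathcal{H}$ if and only if there exists $\alpha\in\mathcal{K}_\infty$ such that each maximal solution $\phi$ to $\mathcal{H}$ satisfies $|\phi(t,j)|_{\mathcal{A}}\le\alpha(|\phi(0,0)|_{\mathcal{A}})$ for all $(t,j)\in\operatorname{dom}\phi$.
   Context: **Metric notions.** The distance $d_{\mathcal{M}}$ is compatible with the topology if its open balls generate the manifold topology; $|x|_{\mathcal{A}}=\inf_{y\in\mathcal{A}}d_{\mathcal{M}}(x,y)$. $\mathcal{M}$ is complete if every Cauchy sequence for $d_{\mathcal{M}}$ converges. The Riemannian distance on a connected component is the infimum of lengths of $C^1$-curves joining two points. $\mathcal{K}_\infty$: functions $\mathbb{R}_{\ge0}\to\mathbb{R}_{\ge0}$ that are zero at zero, continuous, strictly increasing and unbounded. **Hybrid systems.** A geometric hybrid dynamical system $\mathcal{H}=(C,F,D,G,\mathcal{M})$ is $\dot x\in F(x)$ for $x\in C$, $x^+\in G(x)$ for $x\in D$, where $\mathcal{M}$ is a finite-dimensional $C^1$-manifold (second countable, Hausdorff), $C,D\subset\mathcal{M}$, $F:\mathcal{M}\rightrightarrows \mathrm{T}\mathcal{M}$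 is set-valued with $F(x)\subset \mathrm{T}_x\mathcal{M}$ for each $x$, and $G:\mathcal{M}\rightrightarrows\mathcal{M}$ is set-valued. **Solutions.** A compact hybrid time domain is a set $\bigcup_{j=0}^{J}[t_j,t_{j+1}]\times\{j\}\subset\mathbb{R}_{\ge0}\times\mathbb{N}$ with $0=t_0\le t_1\le\dots\le t_{J+1}$; a hybrid time domain is a union of compact hybrid time domains $E_0\subset E_1\subset\cdots$. A function $\gamma:I\to\mathcal{M}$ on an interval is locally absolutely continuous if $\psi\circ\gamma$ is locally absolutely continuous for each $C^1$-function $\psi:\mathcal{M}\to\mathbb{R}$. A hybrid arc is a function $\phi:\operatorname{dom}\phi\to\mathcal{M}$, with $\operatorname{dom}\phi$ a hybrid time domain, such that for each $j$, $t\mapsto\phi(t,j)$ is locally absolutely continuous on $I^j=\{t:(t,j)\in\operatorname{dom}\phi\}$. A hybrid arc $\phi$ is a solution to $\mathcal{H}$ if: $\phi(0,0)\in\overline{C}\cup D$; for each $j$ with $\operatorname{int}I^j\ne\varnothing$, $\phi(t,j)\in C$ for all $t\in\operatorname{int}I^j$ and $\frac{d\phi}{dt}(t,j)\in F(\phi(t,j))$ for almost all $t\in I^j$; and for each $(t,j)\in\operatorname{dom}\phi$ with $(t,j+1)\in\operatorname{dom}\phi$, $\phi(t,j)\in D$ and $\phi(t,j+1)\in G(\phi(t,j))$. A solution is maximal if it is not the restriction of another solution with strictly larger domain. $\mathcal{S}_{\mathcal{H}}(K)$ is the set of maximal solutions with $\phi(0,0)\in K$; $\operatorname{rge}$ is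 the range. **Stability.** A compact neighborhood of $\mathcal{A}$ is a compact set whose interior contains $\mathcal{A}$. A nonempty compact $\mathcal{A}$ is uniformly Lyapunov stable for $\mathcal{H}$ if for each neighborhood $U$ of $\mathcal{A}$ there is a neighborhood $W$ of $\mathcal{A}$ such that $\operatorname{rge}\phi\subset U$ for each $\phi\in\mathcal{S}_{\mathcal{H}}(W)$; uniformly Lagrange stable if for each compact neighborhood $W$ of $\mathcal{A}$ there is a compact neighborhood $U$ of $\mathcal{A}$ such that $\operatorname{rge}\phi\subset U$ for each $\phi\in\mathcal{S}_{\mathcal{H}}(W)$; uniformly globally stable if both hold. *)

(* Defs.v *)
From HB Require Import structures.
From mathcomp Require Import all_boot all_order all_algebra.
From mathcomp Require Import all_classical all_reals all_analysis.
Set Implicit Arguments.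
Unset Strict Implicit.
Unset Printing Implicit Defensive.
Import Order.TTheory GRing.Theory Num.Theory.
Import numFieldNormedType.Exports.
Local Open Scope classical_set_scope.
Local Open Scope ring_scope.

(* For an open set U the directional differentials are continuous in the base
   point iff the total differential is, since all our domains are R^n. *)
Definition C1_on (R : realType) (n : nat) (W : normedModType R)
    (U : set 'rV[R]_n) (f : 'rV[R]_n -> W) : Prop :=
  forall x, U x ->
    differentiable f x /\
    forall v : 'rV[R]_n, {for x, continuous (fun y => 'd f y v)}.

(* A C^1-manifold, presented by an atlas.  The coordinate maps and their
   inverses are total functions, meaningful on [cdom i] and on its image only.
   The dimension may depend on the chart, hence on the connected component.
   [chart_at] singles out one chart around each point; it serves only to read
   the tangent space at that point in coordinates. *)
Record C1_manifold (R : realType) := C1Manifold {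
  carrier :> topologicalType;
  chart : Type;
  cdim : chart -> nat;
  cdom : chart -> set carrier;
  coord : forall i : chart, carrier -> 'rV[R]_(cdim i);
  param : forall i : chart, 'rV[R]_(cdim i) -> carrier;
  chart_at : carrier -> chart;
  open_cdom : forall i, open (cdom i);
  open_coord_image : forall i, open (coord i @` cdom i);
  coordK : forall i x, cdom i x -> param (coord i x) = x;
  coord_continuous : forall i x, cdom i x -> {for x, continuous (coord i)};
  param_continuous : forall i x, cdom i x ->
    {for coord i x, continuous (@param i)};
  cdom_chart_at : forall x, cdom (chart_at x) x;
  transition_C1 : forall i j,
    C1_on (coord i @` (cdom i `&` cdom j)) (coord j \o @param i);
  manifold_hausdorff : hausdorff_space carrier;
  manifold_second_countable : @second_countable carrier
}.

Arguments chart {R} M : rename.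
Arguments cdim {R M} i : rename.
Arguments cdom {R M} i : rename.
Arguments coord {R M} i x : rename.
Arguments param {R M} i y : rename.
Arguments chart_at {R M} x : rename.

(* T_x M, in the coordinates of the chart [chart_at x]. *)
Definition tangent (R : realType) (M : C1_manifold R) (x : M) : Type :=
  'rV[R]_(cdim (chart_at x)).

Definition chart_change (R : realType) (M : C1_manifold R) (i j : chart M)
    (x : M) : 'rV[R]_(cdim i) -> 'rV[R]_(cdim j) :=
  'd (coord j \o param i) (coord i x).

Arguments chart_change {R M} i j x _.

(* The tangent vector at x whose coordinates in the chart i are u, and the
   coordinates in the chart i of the tangent vector v. *)
Definition tangent_of (R : realType) (M : C1_manifold R) (i : chart M) (x : M)
    (u : 'rV[R]_(cdim i)) : tangent x :=
  chart_change i (chart_at x) x u.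

Arguments tangent_of {R M} i x u.

Definition tangent_coord (R : realType) (M : C1_manifold R) (i : chart M)
    (x : M) (v : tangent x) : 'rV[R]_(cdim i) :=
  chart_change (chart_at x) i x v.

Arguments tangent_coord {R M} i {x} v.

Section Geometry.
Context {R : realType} {M : C1_manifold R}.

Definition C1_function (psi : M -> R) : Prop :=
  forall i : chart M, C1_on (coord i @` cdom i) (psi \o param i).

(* v is the velocity at t of c : I -> M (one-sided at an endpoint of I).
   Continuity at t makes the value of [coord] off the chart irrelevant. *)
Definition has_velocity (c : R -> M) (I : set R) (t : R) (v : tangent (c t)) :
    Prop :=
  (c @ within I (nbhs t) --> c t) /\
  ((fun s : R => (s - t)^-1 *:
     (coord (chart_at (c t)) (c s) - coord (chart_at (c t)) (c t)))
   @ within I t^' --> (v : 'rV[R]_(cdim (chart_at (c t))))).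

(* c is C^1 on [a, b] with velocity field v: v is continuous as a map into the
   tangent bundle, that is, its coordinates in each chart are. *)
Definition C1_curve (a b : R) (c : R -> M) (v : forall t, tangent (c t)) :
    Prop :=
  (forall t, t \in `[a, b] -> has_velocity `[a, b] (v t)) /\
  (forall (i : chart M) t, t \in `[a, b] -> cdom i (c t) ->
     (fun s => tangent_coord i (v s)) @ within `[a, b] (nbhs t)
       --> tangent_coord i (v t)).

End Geometry.

Record riemannian_metric (R : realType) (M : C1_manifold R) :=
  RiemannianMetric {
  inner :> forall x : M, tangent x -> tangent x -> R;
  inner_sym : forall x (u v : tangent x), inner u v = inner v u;
  inner_linear : forall x (a : R) (u v w : 'rV[R]_(cdim (chart_at x))),
    @inner x (a *: u + v) w = a * @inner x u w + @inner x v w;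
  inner_pos : forall x (u : 'rV[R]_(cdim (chart_at x))),
    u != 0 -> 0 < @inner x u u;
  inner_continuous : forall (i : chart M) (u w : 'rV[R]_(cdim i)) (x : M),
    cdom i x ->
    {for x, continuous (fun y : M => inner (tangent_of i y u) (tangent_of i y w))}
}.

Section Metric.
Context {R : realType} {M : C1_manifold R}.

Definition curve_length (g : riemannian_metric M) (a b : R) (c : R -> M)
    (v : forall t, tangent (c t)) : \bar R :=
  (\int[lebesgue_measure]_(t in `[a, b]) (Num.sqrt (g (c t) (v t) (v t)))%:E)%E.

Definition riemannian_distance (g : riemannian_metric M) (x y : M) : \bar R :=
  ereal_inf [set L | exists (a b : R) (c : R -> M) (v : forall t, tangent (c t)),
    [/\ a < b, C1_curve a b v, c a = x, c b = y & L = curve_length g a b v]].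

Definition is_distance (d : M -> M -> R) : Prop :=
  [/\ forall x y, 0 <= d x y,
      forall x y, d x y = 0 <-> x = y,
      forall x y, d x y = d y x
    & forall x y z, d x z <= d x y + d y z].

(* The open balls form a base of the manifold topology. *)
Definition compatible_distance (d : M -> M -> R) : Prop :=
  forall (x : M) (U : set M),
    nbhs x U <-> exists2 e : R, 0 < e & [set y | d x y < e] `<=` U.

Definition complete_distance (d : M -> M -> R) : Prop :=
  forall u : nat -> M,
    (forall e : R, 0 < e -> exists N : nat,
       forall m n : nat, (N <= m)%N -> (N <= n)%N -> d (u m) (u n) < e) ->
    exists x : M, u @ \oo --> x.

Definition extends_riemannian_distance (g : riemannian_metric M)
    (d : M -> M -> R) : Prop :=
  forall x y : M, connected_component [set: M] x y ->
    (d x y)%:E = riemannian_distance g x y.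

Definition finitely_many_components : Prop :=
  finite_set (range (fun x : M => connected_component [set: M] x)).

Definition dist_to (d : M -> M -> R) (A : set M) (x : M) : R :=
  inf [set d x y | y in A].

End Metric.

Arguments finitely_many_components {R} M.

(* Functions on R_{>=0} are total functions restricted to [0, +oo[; their values
   there are nonnegative by [alpha 0 = 0] and monotonicity. *)
Definition class_Kinfty (R : realType) (alpha : R -> R) : Prop :=
  [/\ alpha 0 = 0,
      {within `[0, +oo[, continuous alpha},
      (forall r s : R, 0 <= r -> r < s -> alpha r < alpha s)
    & (forall B : R, exists2 r : R, 0 <= r & B < alpha r)].

Section Absolute_continuity.
Context {R : realType}.

Definition abs_continuous_on (f : R -> R) (a b : R) : Prop :=
  forall e : R, 0 < e -> exists2 delta : R, 0 < delta &
    forall (n : nat) (l r : 'I_n -> R),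
      (forall i, [/\ a <= l i, l i <= r i & r i <= b]) ->
      (forall i j, i != j -> r i <= l j \/ r j <= l i) ->
      \sum_(i < n) (r i - l i) < delta ->
      \sum_(i < n) `|f (r i) - f (l i)| < e.

Definition loc_abs_continuous (f : R -> R) (I : set R) : Prop :=
  forall a b : R, a <= b -> `[a, b] `<=` I -> abs_continuous_on f a b.

Definition curve_loc_abs_continuous (M : C1_manifold R) (c : R -> M)
    (I : set R) : Prop :=
  forall psi : M -> R, C1_function psi -> loc_abs_continuous (psi \o c) I.

End Absolute_continuity.

Record hybrid_system (R : realType) (M : C1_manifold R) := HybridSystem {
  flow_set : set M;
  flow_map : forall x : M, set (tangent x);
  jump_set : set M;
  jump_map : M -> set M
}.

(* A function on a subset [hdom] of R x nat; values elsewhere are irrelevant. *)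
Record hybrid_function (R : realType) (M : C1_manifold R) := HybridFunction {
  hdom : set (R * nat);
  hval :> R -> nat -> M
}.

Section Hybrid.
Context {R : realType} {M : C1_manifold R}.
Implicit Types (H : hybrid_system M) (phi : hybrid_function M).

Definition compact_hybrid_time_domain (E : set (R * nat)) : Prop :=
  exists (J : nat) (t : nat -> R),
    [/\ t 0%N = 0,
        forall j, (j <= J)%N -> t j <= t j.+1
      & E = [set p | (p.2 <= J)%N /\ t p.2 <= p.1 <= t p.2.+1]].

Definition hybrid_time_domain (E : set (R * nat)) : Prop :=
  exists2 K : nat -> set (R * nat),
    (forall k, compact_hybrid_time_domain (K k) /\ K k `<=` K k.+1)
    & E = \bigcup_k K k.

Definition hslice phi (j : nat) : set R := [set t | hdom phi (t, j)].

Definition hrange phi : set M := [set phi p.1 p.2 | p in hdom phi].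

Definition hybrid_arc phi : Prop :=
  hybrid_time_domain (hdom phi) /\
  forall j, curve_loc_abs_continuous (phi ^~ j) (hslice phi j).

Definition flows H phi (j : nat) : Prop :=
  (forall t, (hslice phi j)° t -> flow_set H (phi t j)) /\
  {ae lebesgue_measure, forall t : R, hslice phi j t ->
    exists2 v : tangent (phi t j),
      flow_map H v & @has_velocity R M (phi ^~ j) (hslice phi j) t v}.

Definition hybrid_solution H phi : Prop :=
  [/\ hybrid_arc phi,
      (closure (flow_set H) `|` jump_set H) (phi 0 0%N),
      forall j, (hslice phi j)° !=set0 -> flows H phi j
    & forall t j, hdom phi (t, j) -> hdom phi (t, j.+1) ->
        jump_set H (phi t j) /\ jump_map H (phi t j) (phi t j.+1)].

Definition maximal_solution H phi : Prop :=
  hybrid_solution H phi /\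
  ~ exists phi' : hybrid_function M,
      [/\ hybrid_solution H phi',
          hdom phi `<` hdom phi'
        & forall t j, hdom phi (t, j) -> phi' t j = phi t j].

Definition maximal_solutions_from H (K : set M) : set (hybrid_function M) :=
  [set phi | maximal_solution H phi /\ K (phi 0 0%N)].

Definition compact_nbhd (A U : set M) : Prop := compact U /\ A `<=` U°.

Definition uniformly_Lyapunov_stable H (A : set M) : Prop :=
  forall U : set M, set_nbhs A U -> exists2 W : set M, set_nbhs A W &
    forall phi, maximal_solutions_from H W phi -> hrange phi `<=` U.

Definition uniformly_Lagrange_stable H (A : set M) : Prop :=
  forall W : set M, compact_nbhd A W -> exists2 U : set M, compact_nbhd A U &
    forall phi, maximal_solutions_from H W phi -> hrange phi `<=` U.

Definition uniformly_globally_stable H (A : set M) : Prop :=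
  uniformly_Lyapunov_stable H A /\ uniformly_Lagrange_stable H A.

End Hybrid.

(* Main.v *)
(* The metric input is the Hopf-Rinow theorem: closed balls are compact.  The
   supremum rho of the radii of compact balls of a component cannot be finite:
   a point of the ball of radius rho lies, along a nearly minimizing curve, near
   a slightly smaller ball, so an ultrafilter on the ball of radius rho is
   Cauchy; by local compactness the ball can then be enlarged.  Finiteness of
   the set of components passes from one component to the whole manifold.
   Hence the sublevel sets of the distance to the compact set A are compact:
   Lyapunov and Lagrange stability say that the largest distance reached from
   initial distance r tends to 0 with r and is finite, and such a function of r
   is majorized by one of class K-infinity. *)

Require Import Defs.
From HB Require Import structures.
From mathcomp Require Import all_boot all_order all_algebra.
From mathcomp Require Import all_classical all_reals all_analysis.
From mathcomp Require Import lra finmap measurable_realfun.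
Set Implicit Arguments.
Unset Strict Implicit.
Import Order.TTheory GRing.Theory Num.Theory.
Import numFieldNormedType.Exports.
Local Open Scope classical_set_scope.
Local Open Scope ring_scope.

(** * Filters, limits and ultrafilters *)

Lemma eventually_invS_lt {R : realType} (e : R) : 0 < e ->
  exists N : nat, forall n, (N <= n)%N -> (n.+1%:R^-1 : R) < e.
Proof.
move=> e0; have [N _ hN] := near_infty_natSinv_lt (PosNum e0).
by exists N => n; exact: hN.
Qed.

Lemma closed_limit {T : topologicalType} (C : set T) (F : set_system T)
    (x : T) : ProperFilter F -> closed C -> F C -> F --> x -> C x.
Proof.
move=> PF cC FC Fx; apply: cC => B nB.
exact: filter_ex (filterI FC (Fx _ nB)).
Qed.

(** If no [B] were in [F], all the complements would be, hence also their finite intersection, which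
    misses the union. *)
Lemma ultra_finite_cover {T : Type} (F : set_system T) (P : set (set T)) :
  UltraFilter F -> finite_set P -> F (\bigcup_(B in P) B) ->
  exists2 B, P B & F B.
Proof.
move=> UF fP FP; apply: contrapT => nP.
have FC : F (\bigcap_(B in [set` fset_set P]) ~` B).
  apply: filter_bigI => B; rewrite in_fset_set// => /set_mem PB.
  have [FB|//] := in_ultra_setVsetC B UF.
  by exfalso; apply: nP; exists B.
have [x [[B PB Bx] Cx]] := filter_ex (filterI FP FC).
by apply: (Cx B) => //=; rewrite in_fset_set//; exact: mem_set.
Qed.

(** * Distance to a compact set and the Hopf-Rinow theorem *)

Section Distance.
Context {R : realType} {M : C1_manifold R} {d : M -> M -> R}.
Hypotheses (hdist : is_distance d) (htop : compatible_distance d).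

Lemma dist_ge0 x y : 0 <= d x y. Proof. by case: hdist. Qed.

Lemma distxx x : d x x = 0.
Proof. by case: hdist => _ h _ _; apply/h. Qed.

Lemma dist_sym x y : d x y = d y x. Proof. by case: hdist. Qed.

Lemma dist_triangle x y z : d x z <= d x y + d y z.
Proof. by case: hdist. Qed.

Lemma nbhs_dist x (e : R) : 0 < e -> nbhs x [set y | d x y < e].
Proof. by move=> e0; apply/htop; exists e. Qed.

Lemma cvg_dist (F : set_system M) x : Filter F ->
  (forall e : R, 0 < e -> F [set y | d x y < e]) -> F --> x.
Proof.
by move=> FF h U /htop[e e0 eU]; apply: (filterS eU); exact: h.
Qed.

Lemma dist_lipschitz_continuous (f : M -> R) :
  (forall x y, f y <= f x + d x y) -> continuous f.
Proof.
move=> hf x; apply/cvgrPdist_lt => e e0.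
apply: filterS (nbhs_dist x e0) => y /= dxy.
by have := hf x y; have := hf y x; rewrite (dist_sym y x) ltr_norml; lra.
Qed.

Lemma dist_continuous p : continuous (d p).
Proof. by apply: dist_lipschitz_continuous => x y; exact: dist_triangle. Qed.

Lemma closed_dist_le p (r : R) : closed [set y | d p y <= r].
Proof.
apply: (@preimage_closed _ _ (d p) [set t | t <= r]) => [x _|].
  exact: dist_continuous.
exact: closed_le.
Qed.

Section Dist_to.
Context {A : set M}.
Hypothesis A0 : A !=set0.

Lemma dist_to_has_inf x : has_inf [set d x y | y in A].
Proof.
split; first by case: A0 => a Aa; exists (d x a); exists a.
by exists 0 => _ [y _ <-]; exact: dist_ge0.
Qed.

Lemma dist_to_ge0 x : 0 <= dist_to d A x.
Proof.
apply: lb_le_inf; first by case: (dist_to_has_inf x).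
by move=> _ [y _ <-]; exact: dist_ge0.
Qed.

Lemma dist_to_le x y : A y -> dist_to d A x <= d x y.
Proof.
move=> Ay; apply: ge_inf; first by case: (dist_to_has_inf x).
by exists y.
Qed.

Lemma dist_to_lt x (e : R) : dist_to d A x < e -> exists2 y, A y & d x y < e.
Proof.
by move=> /(inf_lt (dist_to_has_inf x).1)[_ [y Ay <-] dxy]; exists y.
Qed.

Lemma dist_to_in x : A x -> dist_to d A x = 0.
Proof.
move=> Ax; apply/eqP; rewrite eq_le dist_to_ge0 andbT.
by rewrite -(distxx x); exact: dist_to_le.
Qed.

Lemma dist_to_continuous : continuous (dist_to d A).
Proof.
apply: dist_lipschitz_continuous => x y.
apply/ler_addgt0Pl => e e0.
have [|a Aa] := @dist_to_lt x (dist_to d A x + e); first by lra.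
have := dist_to_le y Aa; have := dist_triangle y x a.
by rewrite (dist_sym y x); lra.
Qed.

Lemma set_nbhs_dist_to (e : R) : 0 < e -> set_nbhs A [set x | dist_to d A x < e].
Proof.
move=> e0 x Ax; apply: (@dist_to_continuous x [set r | r < e]).
by rewrite dist_to_in//; exact: lt_nbhsl.
Qed.

(** Otherwise points outside [U] come within 1/(n+1) of points of [A]; the latter cluster at some
    [a] in [A], and a ball around [a] inside [U] catches one of the former. *)
Lemma compact_set_nbhs_dist_to (U : set M) : compact A -> set_nbhs A U ->
  exists2 e : R, 0 < e & [set x | dist_to d A x < e] `<=` U.
Proof.
move=> cA nU; apply: contrapT => nex.
have H (n : nat) : exists p : M * M,
    [/\ A p.2, d p.1 p.2 < n.+1%:R^-1 & ~ U p.1].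
  apply: contrapT => np; apply: nex; exists n.+1%:R^-1 => //.
  move=> x /= /dist_to_lt[y Ay dxy]; apply: contrapT => nUx.
  by apply: np; exists (x, y).
have [u hu] := choice H.
have [|a [Aa cla]] := cA ((snd \o u) @ \oo) _.
  by exists 0%N => // n _ /=; case: (hu n).
have [e e0 eU] := (htop a U).1 (nU a Aa).
(* This set, a tail of the sequence, retains the index [n], so a clustering point comes with its
   rate. *)
have := cla [set p | exists2 n : nat, n.+1%:R^-1 < e / 2 & p = (u n).2]
            [set y | d a y < e / 2].
case.
- have [N hN] := eventually_invS_lt (divr_gt0 e0 (ltr0Sn R 1)).
  by exists N => // n Nn; exists n => //; exact: hN.
- by apply: nbhs_dist; rewrite divr_gt0.
move=> _ /= [[n ne ->] da]; have [_ dn] := hu n; apply; apply: eU => /=.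
have := dist_triangle a (u n).2 (u n).1.
by have := lt_trans dn ne; rewrite (dist_sym (u n).2); lra.
Qed.

End Dist_to.

(** A substitute for a finite net: send each [y] in [B] to some [f y] in [K] closer than [e]. The
    image of [F] clusters at some [q] in [K], and since [F] is an ultrafilter, [f y] is [eta]-close
    to [q] on a member of [F]. *)
Lemma ultra_net (F : set_system M) (K B : set M) (e eta : R) :
  UltraFilter F -> compact K -> F B ->
  (forall y, B y -> exists2 z, K z & d z y < e) -> 0 < eta ->
  exists2 q, K q & F [set y | d q y < e + eta].
Proof.
move=> UF cK FB hB eta0.
have H y : exists z, B y -> K z /\ d z y < e.
  have [By|nBy] := pselect (B y); last by exists y.
  by have [z Kz dz] := hB y By; exists z.
have [f hf] := choice H.
have [|q [Kq clq]] := cK (f @ F) _.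
  by apply: (@filterS _ F _ _ _ _ FB) => y /hf[].
exists q => //.
have [FU|FU] := in_ultra_setVsetC (f @^-1` [set z | d q z < eta]) UF.
  apply: filterS (filterI FB FU) => y [/hf[_ dfy] /= dqf].
  by have := dist_triangle q (f y) y; lra.
have [z [/= nz]] := clq (~` [set z | d q z < eta]) _ FU (nbhs_dist q eta0).
by [].
Qed.

(** Otherwise centres with non-compact balls of radii 1/(n+1) cluster at some [a]; for large [n]
    such a ball is a closed subset of a compact ball around [a]. *)
Lemma compact_uniform_local_compactness (K : set M) :
  (forall x, exists2 e : R, 0 < e & compact [set y | d x y <= e]) ->
  compact K ->
  exists2 e : R, 0 < e & forall q, K q -> compact [set y | d q y <= e].
Proof.
move=> hloc cK; apply: contrapT => nex.
have H (n : nat) : exists q, K q /\ ~ compact [set y | d q y <= n.+1%:R^-1].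
  apply: contrapT => np; apply: nex; exists n.+1%:R^-1 => // q Kq.
  by apply: contrapT => nc; apply: np; exists q.
have [u hu] := choice H.
have [|a [Ka cla]] := cK (u @ \oo) _.
  by exists 0%N => // n _ /=; case: (hu n).
have [e e0 ce] := hloc a.
have := cla [set p | exists2 n : nat, n.+1%:R^-1 < e / 2 & p = u n]
            [set y | d a y < e / 2].
case.
- have [N hN] := eventually_invS_lt (divr_gt0 e0 (ltr0Sn R 1)).
  by exists N => // n Nn; exists n => //; exact: hN.
- by apply: nbhs_dist; rewrite divr_gt0.
move=> _ /= [[n ne ->] da]; have [_] := hu n; apply.
apply: subclosed_compact ce _; first exact: closed_dist_le.
by move=> y /= /le_lt_trans/(_ ne) dy; have := dist_triangle a (u n) y; lra.
Qed.

Hypothesis hcomplete : complete_distance d.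

(** Centres of balls of radii 1/(n+1) belonging to [F] form a Cauchy sequence, because any two
    members of [F] meet; its limit is a limit of [F]. *)
Lemma complete_ultra_cvg (F : set_system M) : UltraFilter F ->
  (forall e : R, 0 < e -> exists q, F [set y | d q y < e]) ->
  exists x : M, F --> x.
Proof.
move=> UF hF.
have H (n : nat) : exists q, F [set y | d q y < n.+1%:R^-1].
  exact: hF.
have [u hu] := choice H.
have [e e0|x ux] := @hcomplete u.
  have [N hN] := eventually_invS_lt (divr_gt0 e0 (ltr0Sn R 1)); exists N => m n Nm Nn.
  have [y [/= dm dn]] := filter_ex (filterI (hu m) (hu n)).
  have := dist_triangle (u m) y (u n); rewrite (dist_sym y).
  by have := lt_trans dm (hN _ Nm); have := lt_trans dn (hN _ Nn); lra.
exists x; apply: cvg_dist => e e0.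
have e20 : 0 < e / 2 by rewrite divr_gt0.
have [N1 hN1] := eventually_invS_lt e20.
have [N2 _ hN2] := ux _ (nbhs_dist x e20).
pose n := maxn N1 N2.
apply: filterS (hu n) => y /= dn.
have /= := hN2 n (leq_maxr _ _); have := lt_trans dn (hN1 n (leq_maxl _ _)).
by have := dist_triangle x (u n) y; lra.
Qed.

(* Hopf-Rinow, in the metric form of Cohn-Vossen. *)
Section Hopf_Rinow.
Hypothesis hloc :
  forall x, exists2 e : R, 0 < e & compact [set y | d x y <= e].
(** The length-space property; [near_geodesic_point] supplies it for the Riemannian distance. *)
Hypothesis hlen : forall p y (s eta : R), connected_component [set: M] p y ->
  0 <= s -> d p y < s + eta -> 0 < eta ->
  exists z, [/\ connected_component [set: M] p z, d p z <= s & d z y < eta].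

Let B p (r : R) := connected_component [set: M] p `&` [set y | d p y <= r].

Let closedB p r : closed (B p r).
Proof.
apply: closedI; last exact: closed_dist_le.
by apply: component_closed; exact: closedT.
Qed.

Let compactB_le p r s : r <= s -> compact (B p s) -> compact (B p r).
Proof.
move=> rs cs; apply: subclosed_compact cs _ => // y [py /= dy]; split=> //=.
exact: le_trans rs.
Qed.

Let compactB0 p : compact (B p 0).
Proof.
apply: subclosed_compact (@compact_set1 _ p) _ => // y [_ /= dy].
have /eqP : d p y = 0 by apply/eqP; rewrite eq_le dy dist_ge0.
by case: hdist => _ h _ _ => /eqP/h ->.
Qed.

Lemma component_ball_compact p (r : R) :
  compact (connected_component [set: M] p `&` [set y | d p y <= r]).
Proof.
apply: contrapT => nc; pose S := [set s : R | 0 <= s /\ compact (B p s)].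
have S0 : S 0 by split.
have supS : has_sup S.
  split; first by exists 0.
  exists r => s [_ cs]; rewrite leNgt; apply/negP => rs.
  by apply: nc; apply: compactB_le (ltW rs) cs.
have ubS s : S s -> s <= sup S by apply: ub_le_sup; case: supS.
have rho0 : 0 <= sup S by exact: ubS.
have below s : s < sup S -> compact (B p s).
  move=> /(sup_gt supS.1)[t [_ ct] st].
  exact: compactB_le (ltW st) ct.
have crho : compact (B p (sup S)).
  rewrite compact_ultra => F UF FB.
  have [e e0|x Fx] := complete_ultra_cvg UF; last first.
    by exists x; split=> //; apply: closed_limit FB Fx.
  (* Either [s] is below the supremum or the ball is the single point [p]; in both cases it is
     compact, and every point of the larger ball is within [e / 2] of it. *)
  pose s := Num.max 0 (sup S - e / 4).
  have cs : compact (B p s).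
    by rewrite /s; case: leP => _ //; apply: below; lra.
  have s0 : 0 <= s by rewrite le_max lexx.
  have sS : sup S - e / 4 <= s by rewrite le_max lexx orbT.
  have [y [py /= dy]||q _ Fq] := @ultra_net F _ _ (e / 2) (e / 2) UF cs FB.
  - have [||z [pz dz dzy]] := @hlen p y s (e / 2) py s0; [lra|lra|].
    by exists z.
  - lra.
  - by exists q; apply: filterS Fq => y /=; lra.
have [e e0 he] := compact_uniform_local_compactness hloc crho.
(* The larger ball is covered by [e]-balls around points of the compact one, whose closures lie in
   compact balls; this contradicts the supremum. *)
have : S (sup S + e / 4).
  split; first by lra.
  rewrite compact_ultra => F UF FB.
  have [y [py /= dy]||q Kq Fq] := @ultra_net F _ _ (e / 2) (e / 2) UF crho FB.
  - have [||z [pz dz dzy]] := @hlen p y (sup S) (e / 2) py rho0; [lra|lra|].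
    by exists z.
  - lra.
  have := he q Kq; rewrite compact_ultra => /(_ F UF)[|x [_ Fx]].
    by apply: filterS Fq => y /=; lra.
  by exists x; split=> //; apply: closed_limit FB Fx.
by move=> /ubS; lra.
Qed.

(** An ultrafilter on the ball concentrates on one component. As [p] may lie in another one, the
    ball is recentred at a point [c] of that component, at the cost of [d c p] in the radius. *)
Lemma closed_ball_compact p (r : R) : finitely_many_components M ->
  compact [set y | d p y <= r].
Proof.
move=> fin; rewrite compact_ultra => F UF FB.
have [|_ [c _ <-] Fc] := ultra_finite_cover UF fin.
  apply: filterS filterT => x _.
  by exists (connected_component setT x); [exists x|exact: connected_component_refl].
have := @component_ball_compact c (r + d c p); rewrite compact_ultra.
case/(_ F UF) => [|x [_ Fx]].
  apply: filterS (filterI FB Fc) => y [/= dy cy]; split=> //=.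
  by have := dist_triangle c p y; lra.
by exists x; split=> //; apply: closed_limit FB Fx; exact: closed_dist_le.
Qed.

End Hopf_Rinow.

Lemma dist_to_le_compact (A : set M) (r : R) : compact A -> A !=set0 ->
  (forall p r, compact [set y | d p y <= r]) ->
  compact [set x | dist_to d A x <= r].
Proof.
move=> cA A0 hball; have [a Aa] := A0.
have [B AB] : exists B, forall y, A y -> d a y <= B.
  have : compact (d a @` A).
    by apply: continuous_compact cA; apply: continuous_subspaceT; exact: dist_continuous.
  move=> /compact_bounded[N [_ hN]]; exists (N + 1) => y Ay.
  have := hN (N + 1) (ltac:(lra)) (d a y) (ltac:(by exists y)).
  by rewrite /= ger0_norm// dist_ge0.
(* The extra 1 is the slack in choosing a point of [A] nearly realizing the infimum. *)
apply: subclosed_compact (hball a (B + (r + 1))) _.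
  apply: (@preimage_closed _ _ (dist_to d A) [set t | t <= r]) => [x _|].
    exact: dist_to_continuous.
  exact: closed_le.
move=> x /= dx; have [|y Ay dxy] := @dist_to_lt _ A0 x (r + 1); first by lra.
have := AB y Ay; have := dist_triangle a y x; rewrite (dist_sym y x); lra.
Qed.

End Distance.

(** For fixed [x], the supremum of [T] is at most [X - x]; then the supremum over [x] is taken.
    Nonnegativity and the finite [X] make all these differences finite. *)
Lemma leeD_ereal_sup {R : realType} (S T : set (\bar R)) (X : \bar R) :
  X \is a fin_num -> S !=set0 -> T !=set0 ->
  (forall x, S x -> 0 <= x)%E -> (forall x, T x -> 0 <= x)%E ->
  (forall x y, S x -> T y -> x + y <= X)%E ->
  (ereal_sup S + ereal_sup T <= X)%E.
Proof.
move=> Xfin [x0 Sx0] [y0 Ty0] S0 T0 ST.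
have finS x : S x -> x \is a fin_num.
  move=> Sx; rewrite ge0_fin_numE ?S0//.
  apply: (@le_lt_trans _ _ X); last by rewrite ltey_eq Xfin.
  by apply: le_trans (ST _ _ Sx Ty0); rewrite leeDl// T0.
have sup_le x : S x -> (ereal_sup T <= X - x)%E.
  move=> Sx; apply: ge_ereal_sup => y Ty.
  by rewrite leeBrDl ?finS// ST.
have Tfin : ereal_sup T \is a fin_num.
  rewrite ge0_fin_numE; last first.
    by apply: le_trans (T0 _ Ty0) _; exact: ereal_sup_ubound.
  by apply: (le_lt_trans (sup_le _ Sx0)); rewrite ltey_eq fin_numB Xfin finS.
rewrite -leeBrDr//; apply: ge_ereal_sup => x Sx.
by rewrite leeBrDr// -leeBrDl ?finS// sup_le.
Qed.

(** * Riemannian length *)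

Section Length.
Context {R : realType}.
Local Notation mu := (@lebesgue_measure R).
Import HBNNSimple.

(* The integral of a nonnegative function is a supremum over the simple
   functions below it, hence superadditive without any measurability. *)
Lemma ge0_integral_itv_superadditive (f : R -> \bar R) (a b c : R) :
  a <= b -> b <= c -> (forall t, (0 <= f t)%E) ->
  (\int[mu]_(t in `[a, b]) f t + \int[mu]_(t in `[b, c]) f t
     <= \int[mu]_(t in `[a, c]) f t)%E.
Proof.
move=> ab bc f0.
have [Xfin|] := boolP ((\int[mu]_(t in `[a, c]) f t)%E \is a fin_num); last first.
  rewrite ge0_fin_numE ?integral_ge0// -leNgt leye_eq => /eqP ->.
  exact: leey.
rewrite [X in (X + _)%E]ge0_integralE// [X in (_ + X)%E]ge0_integralE//.
apply: leeD_ereal_sup => //.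
- exists (sintegral mu (cst 0)), nnsfun0 => //= t; rewrite patchE.
  by case: ifP.
- exists (sintegral mu (cst 0)), nnsfun0 => //= t; rewrite patchE.
  by case: ifP.
- by move=> _ [h _ <-]; exact: sintegral_ge0.
- by move=> _ [h _ <-]; exact: sintegral_ge0.
move=> _ _ [h1 /= h1f <-] [h2 /= h2f <-].
have mb : measurable (~` [set b]) by exact: measurableC.
(* The two intervals share [b]; erasing [h2] on this null set keeps its integral and lets [h1 + h2]
   stay below [f] at [b]. *)
have -> : sintegral mu h2 = sintegral mu (proj_nnsfun h2 mb).
  rewrite -!integralT_nnsfun -(@integral_setD1 _ _ b)/=.
  - rewrite setTD integral_mkcond; apply: eq_integral => t _.
    rewrite patchE /= mindicE; case: ifP => _; first by rewrite mulr1.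
    by rewrite mulr0.
  - by rewrite setTD.
  - by apply/measurable_EFinP; apply: measurable_funTS; exact: (measurable_funP (HBNNSimple.NonNegSimpleFun.sort h2)).
rewrite -sintegralD// ge0_integralE//; apply: ereal_sup_ubound.
exists (add_nnsfun h1 (proj_nnsfun h2 mb)) => // t /=.
have h10 : 0 <= h1 t by [].
have h20 : 0 <= h2 t by [].
have := h1f t; have := h2f t; rewrite !patchE mindicE !mem_setE !in_itv/=.
(* Off its own interval each simple function is squeezed to 0. *)
case: (ltgtP t b) => tb.
- rewrite (le_trans (ltW tb) bc) /=.
  rewrite lee_fin => h2le h1le.
  have -> : h2 t = 0 by apply/eqP; rewrite eq_le h2le h20.
  by rewrite mul0r addr0; move: h1le; rewrite !andbT.
- rewrite (le_trans ab (ltW tb)) !andbF/= mem_set/=; last first.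
    by move=> tE; move: tb; rewrite tE ltxx.
  rewrite lee_fin => h2le h1le.
  have -> : h1 t = 0 by apply/eqP; rewrite eq_le h1le h10.
  by rewrite mulr1 add0r.
- rewrite memNset/=; last by move=> /(_ tb).
  by rewrite tb ab bc/= mulr0 addr0.
Qed.
End Length.

(** * Curve length and Riemannian distance *)

Section Riemannian_distance.
Context {R : realType} {M : C1_manifold R}.

Lemma C1_curve_sub (a b a' b' : R) (c : R -> M) (v : forall t, tangent (c t)) :
  `[a', b'] `<=` `[a, b] -> C1_curve a b v -> C1_curve a' b' v.
Proof.
move=> sub [vel cont]; split=> [t tI'|i t tI' ct]; have tI := sub t tI'.
  have [ct vt] := vel _ tI; split.
    by apply: cvg_trans ct => P; apply: within_subset.
  by apply: cvg_trans vt => P; apply: within_subset.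
by apply: cvg_trans (cont i t tI ct) => P; apply: within_subset.
Qed.

Lemma C1_curve_continuous (a b : R) (c : R -> M) (v : forall t, tangent (c t)) :
  C1_curve a b v -> {within `[a, b], continuous c}.
Proof.
by move=> [vel _]; apply/subspace_continuousP => t tI; exact: (vel t tI).1.
Qed.

Lemma C1_curve_component (a b : R) (c : R -> M) (v : forall t, tangent (c t))
    s t : C1_curve a b v -> s \in `[a, b] -> t \in `[a, b] ->
  connected_component [set: M] (c s) (c t).
Proof.
move=> /C1_curve_continuous cc sI tI; exists (c @` `[a, b]); last by exists t.
split=> //.
apply: connected_continuous_connected cc.
exact/connected_intervalP/interval_is_interval.
Qed.

Lemma curve_length_superadditive (g : riemannian_metric M) (a b e : R)
    (c : R -> M) (v : forall t, tangent (c t)) : a <= b -> b <= e ->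
  (curve_length g a b v + curve_length g b e v <= curve_length g a e v)%E.
Proof.
move=> ab be; exact: ge0_integral_itv_superadditive.
Qed.

Context {d : M -> M -> R} {g : riemannian_metric M}.
Hypotheses (hdist : is_distance d) (htop : compatible_distance d).
Hypothesis hriem : extends_riemannian_distance g d.

Lemma dist_le_curve_length (a b : R) (c : R -> M)
    (v : forall t, tangent (c t)) : a < b -> C1_curve a b v ->
  ((d (c a) (c b))%:E <= curve_length g a b v)%E.
Proof.
move=> ab cv; rewrite hriem.
  by apply: ereal_inf_lbound; exists a, b, c, v.
by apply: (C1_curve_component cv); rewrite in_itv/= lexx ltW.
Qed.

(* The point at distance [s] from [p] on a nearly minimizing curve to [y]. *)
Lemma near_geodesic_point p y (s eta : R) :
  connected_component [set: M] p y -> 0 <= s -> d p y < s + eta -> 0 < eta ->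
  exists z, [/\ connected_component [set: M] p z, d p z <= s & d z y < eta].
Proof.
move=> py s0 dpy eta0; have [dys|sdy] := leP (d p y) s.
  by exists y; rewrite (distxx hdist).
have : (riemannian_distance g p y < (s + eta)%:E)%E.
  by rewrite -hriem// lte_fin.
move=> /ereal_inf_lt[_ [a [b [c [v [ab cv ca cb ->]]]]] Lse].
have aI : a \in `[a, b] by rewrite in_itv/= lexx ltW.
have bI : b \in `[a, b] by rewrite in_itv/= lexx ltW.
have fc : {within `[a, b], continuous (fun t => d p (c t))}.
  apply/subspace_continuousP => t tI.
  apply: cvg_comp (cv.1 t tI).1 _.
  exact: (dist_continuous hdist htop).
have [|t tI ft] := IVT (v := s) (ltW ab) fc.
  by rewrite ca cb (distxx hdist) ge_min s0 le_max (ltW sdy) orbT.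
exists (c t); split.
- by rewrite -ca; exact: C1_curve_component cv aI tI.
- by rewrite ft.
(* Curves live on nondegenerate intervals, so the endpoints are separate: [t = a] forces [s = 0],
   and [t = b] contradicts [s < d p y]. *)
move: tI; rewrite in_itv/= => /andP[]; rewrite le_eqVlt => /predU1P[ta _|at_].
  by move: dpy ft; rewrite -ta ca (distxx hdist) => dy ss; move: dy; rewrite -ss add0r.
rewrite le_eqVlt => /predU1P[tb|tb].
  by move: sdy; rewrite -ft tb cb ltxx.
have sub1 : `[a, t] `<=` `[a, b].
  by apply: subset_itvl; rewrite bnd_simp ltW.
have sub2 : `[t, b] `<=` `[a, b].
  by apply: subset_itvr; rewrite bnd_simp ltW.
(* The first piece has length at least [s] out of a total below [s + eta], which leaves less than
   [eta] for the second. *)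
have h1 := dist_le_curve_length at_ (C1_curve_sub sub1 cv).
have h2 := dist_le_curve_length tb (C1_curve_sub sub2 cv).
have := le_lt_trans (curve_length_superadditive g v (ltW at_) (ltW tb)) Lse.
move=> /(le_lt_trans (leeD h1 h2)); rewrite ca cb ft -EFinD lte_fin; lra.
Qed.

End Riemannian_distance.

(** * Local compactness of manifolds *)

Section Local_compactness.
Context {R : realType} {M : C1_manifold R} {d : M -> M -> R}.
Hypotheses (hdist : is_distance d) (htop : compatible_distance d).

(** The neighbourhood is the image under [param] of a closed coordinate ball inside the open chart
    image, compact by Heine-Borel. *)
Lemma manifold_locally_compact (x : M) :
  exists2 N : set M, nbhs x N & compact N.
Proof.
pose i := chart_at x; have ix := cdom_chart_at x.
have : nbhs (Defs.coord i x) (Defs.coord i @` cdom i).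
  by apply: open_nbhs_nbhs; split; [exact: open_coord_image|exists x].
move=> /nbhs_closedballP[e he]; pose K := closed_ball (Defs.coord i x) e%:num.
exists (param i @` K).
  have nK : nbhs x (Defs.coord i @^-1` K).
    apply: (Defs.coord_continuous ix); apply: filterS (nbhsx_ballx _ _ (gt0 e)).
    exact: subset_closed_ball.
  apply: filterS (filterI nK (open_nbhs_nbhs (conj (open_cdom i) ix))).
  by move=> y [Ky iy]; exists (Defs.coord i y) => //; exact: coordK.
apply: continuous_compact.
  apply/subspace_continuousP => w /he[y iy <-].
  apply: cvg_trans (param_continuous iy).
  by apply: cvg_app; exact: cvg_within.
apply: bounded_closed_compact; last exact: closed_ball_closed.
exists (`|Defs.coord i x| + e%:num); split=> [|N hN w]; first exact: num_real.
rewrite /K closed_ballE// /closed_ball_/= => dw; apply: le_trans (ltW hN).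
rewrite -[w in leLHS](subKr (Defs.coord i x)).
exact: le_trans (ler_normB _ _) (lerD (lexx _) dw).
Qed.

Lemma closed_ball_locally_compact x :
  exists2 e : R, 0 < e & compact [set y | d x y <= e].
Proof.
have [N /htop[e e0 eN] cN] := manifold_locally_compact x.
exists (e / 2); first by rewrite divr_gt0.
apply: subclosed_compact cN _; first exact: closed_dist_le.
by move=> y /= dy; apply: eN => /=; lra.
Qed.

End Local_compactness.

(** * Majorants of class K-infinity *)

Section Kinfty_majorant.
Context {R : realType}.

Let ramp (u : R) : R := if u <= 2^-1 then 0 else if u <= 1 then 2 * u - 1 else 1.

Let ramp_ge0 u : 0 <= ramp u.
Proof. by rewrite /ramp; case: (leP u 2^-1); case: (leP u 1); lra. Qed.

Let ramp_le1 u : ramp u <= 1.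
Proof. by rewrite /ramp; case: (leP u 2^-1); case: (leP u 1); lra. Qed.

Let ramp_eq0 u : u <= 2^-1 -> ramp u = 0.
Proof. by rewrite /ramp => ->. Qed.

Let ramp_eq1 u : 1 <= u -> ramp u = 1.
Proof. by rewrite /ramp; case: (leP u 2^-1); case: (leP u 1); lra. Qed.

Let ramp_le u v : u <= v -> ramp u <= ramp v.
Proof.
rewrite /ramp; case: (leP u 2^-1); case: (leP v 2^-1);
  by case: (leP u 1); case: (leP v 1); lra.
Qed.

Let ramp_lipschitz u v : u <= v -> ramp v <= ramp u + 2 * (v - u).
Proof.
rewrite /ramp; case: (leP u 2^-1); case: (leP v 2^-1);
  by case: (leP u 1); case: (leP v 1); lra.
Qed.

(* The supremum over (s, b) in S of b times a continuous ramp in r / s which is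
   0 for r <= s / 2 and 1 for r >= s: near any r > 0 only a bounded set of b
   and uniformly Lipschitz ramps contribute. *)
Lemma class_Kinfty_majorant (S : set (R * R)) :
  (forall p, S p -> 0 <= p.1 /\ 0 <= p.2) ->
  (forall r : R, exists B : R, forall p, S p -> p.1 <= r -> p.2 <= B) ->
  (forall e : R, 0 < e ->
     exists2 delta : R, 0 < delta & forall p, S p -> p.1 < delta -> p.2 <= e) ->
  exists2 alpha : R -> R, class_Kinfty alpha &
    forall p, S p -> p.2 <= alpha p.1.
Proof.
move=> S_ge0 S_bnd S_small.
(* The element 0 keeps the set nonempty and its supremum nonnegative. Pairs with [p.1 = 0]
   contribute 0, since division by 0 gives 0. *)
pose T r := [set x | x = 0 \/ exists2 p, S p & x = p.2 * ramp (r / p.1)].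
pose beta r := sup (T r).
have T0 r : T r 0 by left.
have term_le r p B : S p -> 0 <= r -> 0 <= B ->
    (p.1 <= 2 * r -> p.2 <= B) -> p.2 * ramp (r / p.1) <= B.
  move=> Sp r0 B0 pB; have [p1 p2] := S_ge0 p Sp.
  have [pr|rp] := leP p.1 (2 * r).
    by apply: le_trans (pB pr); rewrite ler_piMr.
  rewrite ramp_eq0 ?mulr0//.
  have pp : 0 < p.1 by lra.
  by rewrite ler_pdivrMr//; lra.
have beta_le r B : 0 <= r -> 0 <= B ->
    (forall p, S p -> p.1 <= 2 * r -> p.2 <= B) -> beta r <= B.
  move=> r0 B0 SB; apply: sup_le_ub; first by exists 0.
  by move=> x [->//|[p Sp ->]]; apply: term_le => //; exact: SB.
have bnd r : exists2 B : R, 0 <= B & forall p, S p -> p.1 <= r -> p.2 <= B.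
  have [B SB] := S_bnd r; exists (Num.max 0 B); first by rewrite le_max lexx.
  by move=> p Sp pr; rewrite le_max (SB p Sp pr) orbT.
have T_sup r : 0 <= r -> has_sup (T r).
  move=> r0; split; first by exists 0.
  have [B B0 SB] := bnd (2 * r); exists B.
  by move=> x [->//|[p Sp ->]]; apply: term_le => //; exact: SB.
have le_beta r x : 0 <= r -> T r x -> x <= beta r.
  by move=> r0; apply: ub_le_sup; case: (T_sup r r0).
have beta_ge0 r : 0 <= r -> 0 <= beta r by move=> r0; exact: le_beta.
have beta_nd r s : 0 <= r -> r <= s -> beta r <= beta s.
  move=> r0 rs; have s0 := le_trans r0 rs.
  apply: sup_le_ub; first by exists 0.
  move=> x [->|[p Sp ->]]; first exact: beta_ge0.
  apply: (@le_trans _ _ (p.2 * ramp (s / p.1))).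
    have [p1 p2] := S_ge0 p Sp.
    by rewrite ler_wpM2l// ramp_le// ler_wpM2r// invr_ge0.
  by apply: le_beta => //; right; exists p.
(* Terms with [p.1 > 2 * s] vanish at [s], those with [p.1 <= r] do not change between [r] and [s],
   and for the others the slope 2 of the ramp is divided by [p.1 > r]. *)
have beta_lip r s B : 0 < r -> r <= s -> 0 <= B ->
    (forall p, S p -> p.1 <= 2 * s -> p.2 <= B) ->
    beta s <= beta r + B * (2 * (s - r) / r).
  move=> r0 rs B0 SB; have s0 := lt_le_trans r0 rs; have r0' := ltW r0.
  have q0 : 0 <= 2 * (s - r) / r.
    by rewrite divr_ge0 ?mulr_ge0// ?subr_ge0// ltW.
  apply: sup_le_ub; first by exists 0.
  move=> x [->|[p Sp ->]]; first by apply: addr_ge0; [exact: beta_ge0|exact: mulr_ge0].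
  have [p1 p2] := S_ge0 p Sp.
  have [ps|sp] := leP p.1 (2 * s); last first.
    rewrite ramp_eq0; last first.
      have pp : 0 < p.1 by lra.
      by rewrite ler_pdivrMr//; lra.
    by rewrite mulr0; apply: addr_ge0; [exact: beta_ge0|exact: mulr_ge0].
  have ramp_sr : ramp (s / p.1) <= ramp (r / p.1) + 2 * (s - r) / r.
    have [pr|rp] := leP p.1 r.
      have [p10|p10] := eqVneq p.1 0.
        by rewrite p10 invr0 !mulr0 lerDl.
      have pp : 0 < p.1 by rewrite lt_neqAle eq_sym p10.
      rewrite (ramp_eq1 (u := r / p.1)); last by rewrite ler_pdivlMr// mul1r.
      by rewrite (le_trans (ramp_le1 _))// lerDl.
    have pp : 0 < p.1 by exact: lt_trans rp.
    apply: le_trans (ramp_lipschitz (u := r / p.1) _) _.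
      by rewrite ler_wpM2r// invr_ge0.
    rewrite lerD2l -mulrBl mulrA ler_wpM2l ?mulr_ge0 ?subr_ge0//.
    by rewrite lef_pV2 ?posrE// ltW.
  apply: le_trans (ler_wpM2l p2 ramp_sr) _; rewrite mulrDr lerD//.
    by apply: le_beta; [exact: ltW|right; exists p].
  by rewrite ler_wpM2r// SB.
(* The summand [r] makes the nondecreasing [beta] strictly increasing and unbounded. *)
exists (fun r => r + beta r); last first.
  move=> p Sp; have [p1 p2] := S_ge0 p Sp.
  have [p10|p10] := eqVneq p.1 0.
    (* The smallness hypothesis forces [p.2 <= e] for every positive [e]. *)
    rewrite p10 add0r; apply: (@le_trans _ _ 0); last exact: beta_ge0.
    apply/ler_addgt0Pl => e /S_small[delta d0 Se].
    by rewrite ?addr0 ?add0r; apply: Se; rewrite ?p10.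
  have pp : 0 < p.1 by rewrite lt_neqAle eq_sym p10.
  apply: (@le_trans _ _ (beta p.1)); last by rewrite lerDr.
  apply: le_beta => //; right; exists p => //.
  by rewrite divff// ramp_eq1// mulr1.
have small_beta e : 0 < e ->
    exists2 delta : R, 0 < delta & forall r, 0 <= r -> r < delta -> beta r <= e.
  move=> e0; have [delta d0 Sd] := S_small e e0.
  exists (delta / 2); first by rewrite divr_gt0.
  move=> r r0 rd; apply: beta_le => //; first exact: ltW.
  by move=> p Sp pr; apply: Sd => //; lra.
have beta0 : beta 0 = 0.
  apply/eqP; rewrite eq_le beta_ge0// andbT.
  apply/ler_addgt0Pl => e /small_beta[delta d0 be].
  by rewrite ?addr0 be.
split.
- by rewrite beta0 addr0.
- apply/subspace_continuousP => x /=; rewrite in_itv/= andbT => x0.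
  suff H (e : R) : 0 < e -> exists2 eta : R, 0 < eta &
      forall y, 0 <= y -> `|x - y| < eta -> `|x + beta x - (y + beta y)| < e.
    apply/cvgrPdist_lt => e /H[eta eta0 He].
    apply: filterS (nbhsx_ballx x eta eta0) => y xy /=.
    by rewrite in_itv/= andbT => y0; exact: He.
  move=> e0; move: x0; rewrite le_eqVlt => /predU1P[<-|x0].
    have [delta d0 Hd] := small_beta (e / 2) (divr_gt0 e0 (ltr0Sn R 1)).
    exists (Num.min delta (e / 2)); first by rewrite lt_min d0 divr_gt0.
    move=> y y0; rewrite beta0 !add0r !normrN !ger0_norm ?addr_ge0 ?beta_ge0//.
    by rewrite lt_min => /andP[/(Hd _ y0) ? ?]; lra.
  (* [L] is a Lipschitz constant on [x/2, 2x]: there [2 * s <= 4 * x] and [2 / r <= 4 / x]. *)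
  have [B B0 SB] := bnd (4 * x); pose L := 1 + B * (4 / x).
  have L1 : 1 <= L by rewrite lerDl mulr_ge0// divr_ge0// ltW.
  have key r s : x / 2 <= r -> r <= s -> s <= 2 * x ->
      0 <= s + beta s - (r + beta r) <= L * (s - r).
    move=> xr rs sx; have r0 : 0 < r by lra.
    have := beta_nd r s (ltW r0) rs; have := beta_lip r s B r0 rs B0.
    have qle : 2 * (s - r) / r <= 4 / x * (s - r).
      rewrite mulrAC ler_wpM2r ?subr_ge0//.
      by rewrite ler_pdivrMr// mulrAC ler_pdivlMr//; lra.
    have SBs p : S p -> p.1 <= 2 * s -> p.2 <= B by move=> Sp ps; apply: SB => //; lra.
    move=> /(_ SBs).
    have := ler_wpM2l B0 qle; rewrite /L mulrDl mul1r mulrA; lra.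
  exists (Num.min (x / 2) (e / L)).
    by rewrite lt_min !divr_gt0//; lra.
  move=> y y0; rewrite lt_min (@ltr_pdivlMr _ L); last lra.
  rewrite (mulrC _ L); have [xy|yx] := leP x y.
    rewrite distrC (distrC (_ + _)) ger0_norm ?subr_ge0// => /andP[dx de].
    have /andP[k0 kL] := key x y (ltac:(lra)) xy (ltac:(lra)).
    by rewrite ger0_norm//; exact: le_lt_trans kL de.
  rewrite ger0_norm ?subr_ge0 ?(ltW yx)// => /andP[dx de].
  have /andP[k0 kL] := key y x (ltac:(lra)) (ltW yx) (ltac:(lra)).
  by rewrite ger0_norm//; exact: le_lt_trans kL de.
- move=> r s r0 rs; have := beta_nd r s r0 (ltW rs); lra.
- move=> B; exists (Num.max 0 B + 1); first by rewrite addr_ge0// le_max lexx.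
  apply: (@lt_le_trans _ _ (Num.max 0 B + 1)).
    by rewrite ltr_pwDr// le_max lexx orbT.
  by rewrite lerDl beta_ge0// addr_ge0// le_max lexx.
Qed.

End Kinfty_majorant.

(** * Uniform global stability and class K-infinity bounds *)

Unset Implicit Arguments.
Set Strict Implicit.

Theorem propositionB5 (R : realType) (M : C1_manifold R)
    (g : riemannian_metric M) (d : M -> M -> R)
    (hcomp : finitely_many_components M)
    (hdist : is_distance d)
    (htop : compatible_distance d)
    (hriem : extends_riemannian_distance g d)
    (hcomplete : complete_distance d)
    (H : hybrid_system M) (A : set M) (hA0 : A !=set0) (hAc : compact A) :
  uniformly_globally_stable H A <->
  exists2 alpha : R -> R, class_Kinfty alpha &
    forall phi : hybrid_function M, maximal_solution H phi ->
      forall (t : R) (j : nat), hdom phi (t, j) ->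
        dist_to d A (phi t j) <= alpha (dist_to d A (phi 0 0%N)).
Proof.
have hle (r : R) : compact [set x | dist_to d A x <= r].
  apply: (dist_to_le_compact hdist htop) => // p s.
  apply: (closed_ball_compact hdist htop hcomplete) => //.
    exact: closed_ball_locally_compact.
  exact: near_geodesic_point hriem.
have hdc := dist_to_continuous hdist htop hA0.
have hnbhs := set_nbhs_dist_to hdist htop hA0.
have hge0 := dist_to_ge0 hdist hA0.
have hcn (r : R) : 0 < r -> compact_nbhd A [set x | dist_to d A x <= r].
  move=> r0; split=> // x Ax.
  by apply: filterS (hnbhs r r0 x Ax) => y /= /ltW.
split=> [[lyap lagr]|[alpha [a0 acont ainc _] ha]].
  (* The pairs are initial distance and reached distance: Lagrange stability bounds them, Lyapunov
     stability makes them small near 0. *)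
  have [||e e0|alpha Ka Ha] := @class_Kinfty_majorant R [set p | exists phi t j,
    [/\ maximal_solution H phi, hdom phi (t, j) &
      p = (dist_to d A (phi 0 0%N), dist_to d A (phi t j))]].
  - by move=> _ [phi [t [j [_ _ ->]]]] /=; split; exact: hge0.
  (* A positive radius makes the sublevel set a compact neighbourhood of [A]. *)
  - move=> r; have r1 : 0 < Num.max 1 r by rewrite lt_max ltr01.
    have [U [cU _] HU] := lagr _ (hcn _ r1).
    have : compact (dist_to d A @` U).
      by apply: continuous_compact cU; exact: continuous_subspaceT.
    move=> /compact_bounded[N [_ hN]]; exists (N + 1).
    move=> _ [phi [t [j [mphi tj ->]]]] /= phir.
    have Uphi : U (phi t j).
      apply: (HU phi); last by exists (t, j).
      by split=> //=; rewrite le_max phir orbT.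
    have := hN (N + 1) (ltac:(lra)) (dist_to d A (phi t j)).
    by rewrite /= ger0_norm//; apply; exists (phi t j).
  - have [W nW HW] := lyap _ (hnbhs e e0).
    have [delta d0 dW] := compact_set_nbhs_dist_to hdist htop hA0 hAc nW.
    exists delta => // _ [phi [t [j [mphi tj ->]]]] /= phid.
    apply/ltW; apply: (HW phi); last by exists (t, j).
    by split=> //; exact: dW.
  exists alpha => // phi mphi t j tj.
  by apply: (Ha (_, _)); exists phi, t, j.
have amono r s : 0 <= r -> r <= s -> alpha r <= alpha s.
  move=> r0; rewrite le_eqVlt => /predU1P[->//|rs].
  by apply/ltW; exact: ainc.
split=> [U nU|W [cW AW]].
  have [e e0 eU] := compact_set_nbhs_dist_to hdist htop hA0 hAc nU.
  (* Lyapunov stability is the continuity of [alpha] at 0. *)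
  have : alpha @ within `[0, +oo[ (nbhs (0:R)) --> alpha 0.
    by move/subspace_continuousP : acont; apply; rewrite /= in_itv/= lexx.
  rewrite a0 => /cvgr_lt/(_ e e0)/nbhs_ballP[delta /= delta0 hdelta].
  exists [set x | dist_to d A x < delta]; first exact: hnbhs.
  move=> phi [mphi /= phid] _ [[t j] tj <-] /=; apply: eU => /=.
  apply: le_lt_trans (ha phi mphi t j tj) _; apply: hdelta.
    by rewrite /ball/= sub0r normrN ger0_norm.
  by rewrite /= in_itv/= hge0.
have : compact (dist_to d A @` W).
  by apply: continuous_compact cW; exact: continuous_subspaceT.
move=> /compact_bounded[N [_ hN]].
(* [N + 1] bounds the distance to [A] on [W]; the 1 ensures [0 < alpha r], so that the sublevel set
   below is a compact neighbourhood. *)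
pose r := Num.max 1 (N + 1).
have r1 : 0 < r by rewrite lt_max ltr01.
exists [set x | dist_to d A x <= alpha r].
  by apply: hcn; rewrite -a0 ainc.
move=> phi [mphi /= Wphi] _ [[t j] tj <-] /=.
apply: le_trans (ha phi mphi t j tj) _; apply: amono => //.
rewrite le_max; apply/orP; right.
have := hN (N + 1) (ltac:(lra)) (dist_to d A (phi 0 0%N)).
by rewrite /= ger0_norm//; apply; exists (phi 0 0%N).
Qed.
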